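(* Let $S$ be a $t$-conorm, $N$ a fuzzy negation, $T$ a $t$-norm, and $N'$ a fuzzy negation. Let $I_{S,N,T}(x,y)=S(N(T(x,N(y))),N(x))$ and define $T^{N'}:[0,1]^2\to[0,1]$ by $T^{N'}(x,y)=N'(I_{S,N,T}(x,N'(y)))$. Then: (i) $T^{N'}(0,x)=T^{N'}(x,0)=0$ for all $x\in[0,1]$; (ii) $T^{N'}$ is non-decreasing in both variables; (iii) if $S=\max$, $T=\min$ and $N=N'$ is strong, then $T^{N'}$ is commutative; (iv) if $S=\max$, $T=\min$ and $N=N'$ is strong, then $T^{N'}(x,1)=x$ for all $x\in[0,1]$; (v) if $S=\max$, $T=\min$ and $N=N'$ is strong, then $T^{N'}$ is associative.
   Context: A $t$-norm is a function $T:[0,1]^2\to[0,1]$ that is commutative, associative, non-decreasing in each argument and satisfies $T(x,1)=x$. A $t$-conorm is a function $S:[0,1]^2\to[0,1]$ that is commutative, associative, non-decreasing in each argument and satisfies $S(x,0)=x$. A fuzzy negation is a non-increasing $N:[0,1]\to[0,1]$ with $N(0)=1$, $N(1)=0$; it is strong if $N(N(x))=x$ for all $x$. Here $\max$ and $\min$ denote the $t$-conorm $(x,y)\mapsto\max\{x,y\}$ and the $t$-norm $(x,y)\mapsto\min\{x,y\}$. *)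

(* Defs.v *)
From HB Require Import structures.
From mathcomp Require Import all_boot all_order all_algebra.
From mathcomp Require Import interval_inference reals.

Set Implicit Arguments.
Unset Strict Implicit.
Unset Printing Implicit Defensive.

Import Order.TTheory GRing.Theory Num.Theory.

Local Open Scope ring_scope.

Definition nondecreasing2 (R : realType)
    (F : {i01 R} -> {i01 R} -> {i01 R}) : Prop :=
  (forall y, {homo F^~ y : x1 x2 / x1 <= x2}) /\
  (forall x, {homo F x : y1 y2 / y1 <= y2}).

Definition tnorm (R : realType) (T : {i01 R} -> {i01 R} -> {i01 R}) : Prop :=
  [/\ commutative T, associative T, nondecreasing2 T &
      forall x, T x 1%:i01 = x].

Definition tconorm (R : realType) (S : {i01 R} -> {i01 R} -> {i01 R}) : Prop :=
  [/\ commutative S, associative S, nondecreasing2 S &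
      forall x, S x 0%:i01 = x].

Definition fuzzy_negation (R : realType) (N : {i01 R} -> {i01 R}) : Prop :=
  [/\ {homo N : x y /~ x <= y}, N 0%:i01 = 1%:i01 & N 1%:i01 = 0%:i01].

Definition strong_negation (R : realType) (N : {i01 R} -> {i01 R}) : Prop :=
  fuzzy_negation N /\ involutive N.

Definition I_SNT (R : realType) (S : {i01 R} -> {i01 R} -> {i01 R})
    (N : {i01 R} -> {i01 R}) (T : {i01 R} -> {i01 R} -> {i01 R})
    (x y : {i01 R}) : {i01 R} :=
  S (N (T x (N y))) (N x).

Definition T_neg (R : realType) (S : {i01 R} -> {i01 R} -> {i01 R})
    (N : {i01 R} -> {i01 R}) (T : {i01 R} -> {i01 R} -> {i01 R})
    (N' : {i01 R} -> {i01 R}) (x y : {i01 R}) : {i01 R} :=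
  N' (I_SNT S N T x (N' y)).

(* Main.v *)
Require Import Defs.
From HB Require Import structures.
From mathcomp Require Import all_boot all_order all_algebra.
From mathcomp Require Import interval_inference reals.

Import Order.TTheory GRing.Theory Num.Theory.

Local Open Scope ring_scope.

(** The boundary values hold because 0 absorbs every t-norm and 1 absorbs every t-conorm ([tnorm0x],
    [tconorm1x]): a zero argument forces the implication to 1, which [N'] sends to 0. Monotonicity
    follows by counting order reversals. In the max/min case with a strong negation, the operator
    collapses to [Num.min] ([T_neg_max_min]), so commutativity, the unit law and associativity are
    those of the minimum. *)

Lemma ge0_i01 (R : realType) (x : {i01 R}) : 0%:i01 <= x.
Proof. by rewrite -num_le ge0. Qed.

Lemma le1_i01 (R : realType) (x : {i01 R}) : x <= 1%:i01.
Proof. by rewrite -num_le le1. Qed.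

(** Monotonicity and the unit law give [T 0 x <= T 0 1 = 0]. *)
Lemma tnorm0x (R : realType) (T : {i01 R} -> {i01 R} -> {i01 R}) :
  tnorm T -> left_zero 0%:i01 T.
Proof.
move=> [_ _ [_ T_homor] Tx1] x; apply/le_anti/andP; split; last exact: ge0_i01.
by rewrite -[leRHS]Tx1; apply/T_homor/le1_i01.
Qed.

(** Dually, [1 = S 1 0 <= S 1 x]. *)
Lemma tconorm1x (R : realType) (S : {i01 R} -> {i01 R} -> {i01 R}) :
  tconorm S -> left_zero 1%:i01 S.
Proof.
move=> [_ _ [_ S_homor] Sx0] x; apply/le_anti/andP; split; first exact: le1_i01.
by rewrite -[leLHS]Sx0; apply/S_homor/ge0_i01.
Qed.

(* Since [N] is antitone, [N x <= N (min x y)], so the maximum in [I_SNT]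
   is attained at its first argument and [N] cancels. *)
Lemma T_neg_max_min (R : realType) (S : {i01 R} -> {i01 R} -> {i01 R})
    (N : {i01 R} -> {i01 R}) (T : {i01 R} -> {i01 R} -> {i01 R})
    (N' : {i01 R} -> {i01 R}) :
  S =2 Num.max -> T =2 Num.min -> N =1 N' -> strong_negation N' ->
  T_neg S N T N' =2 Num.min.
Proof.
move=> Smax Tmin eqN [[N_anti _ _] NK] x y.
rewrite /T_neg /I_SNT Smax Tmin !eqN NK max_l ?NK //.
by apply: N_anti; rewrite ge_min lexx.
Qed.

Theorem theorem3p3 (R : realType)
    (S : {i01 R} -> {i01 R} -> {i01 R}) (N : {i01 R} -> {i01 R})
    (T : {i01 R} -> {i01 R} -> {i01 R}) (N' : {i01 R} -> {i01 R})
    (hS : tconorm S) (hN : fuzzy_negation N)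
    (hT : tnorm T) (hN' : fuzzy_negation N') :
  (forall x : {i01 R},
     T_neg S N T N' 0%:i01 x = 0%:i01 /\ T_neg S N T N' x 0%:i01 = 0%:i01) /\
  nondecreasing2 (T_neg S N T N') /\
  (S =2 Num.max -> T =2 Num.min -> N =1 N' -> strong_negation N' ->
     commutative (T_neg S N T N')) /\
  (S =2 Num.max -> T =2 Num.min -> N =1 N' -> strong_negation N' ->
     forall x : {i01 R}, T_neg S N T N' x 1%:i01 = x) /\
  (S =2 Num.max -> T =2 Num.min -> N =1 N' -> strong_negation N' ->
     associative (T_neg S N T N')).
Proof.
have [SC _ [S_homol S_homor] _] := hS; have [N_anti N0 _] := hN.
have [TC _ [T_homol T_homor] _] := hT; have [N'_anti N'0 N'1] := hN'.
do !split.
- by rewrite /T_neg /I_SNT N0 SC tconorm1x.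
- rewrite /T_neg /I_SNT N'0; have [_ _ ->] := hN.
  by rewrite TC tnorm0x // N0 tconorm1x.
(* The first variable enters both arguments of [S], so they are changed one at a time, through
   [S (N (T x1 _)) (N x2)]. *)
- move=> y x1 x2 x12; apply: N'_anti.
  apply: (le_trans (S_homol _ _ _ (N_anti _ _ (T_homol _ _ _ x12)))).
  exact/S_homor/N_anti.
(* The second variable passes through four antitone maps, [N'] and [N] twice each, so order is
   preserved. *)
- move=> x y1 y2 y12.
  exact/N'_anti/S_homol/N_anti/T_homor/N_anti/N'_anti.
- by move=> Smax Tmin eqN sN x y; rewrite !T_neg_max_min // minC.
- by move=> Smax Tmin eqN sN x; rewrite T_neg_max_min // min_l // le1_i01.
- by move=> Smax Tmin eqN sN x y z; rewrite !T_neg_max_min // minA.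
Qed.
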